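(* Let $f=\frac1n\sum_{i=1}^n f_i$ with $f$ and each $f_i:\mathbb{R}^d\to\mathbb{R}$ convex and not necessarily smooth, and let $x^*$ be a minimizer of $f$. Assume interpolation, i.e. $f_i(x^* )=f_i^*:=\inf_xf_i(x)$ for every $i$. Let $G>0$ be a constant such that $\|g_i(x)\|^2<G^2$ for all $i\in\{1,\dots,n\}$, all $x\in\mathbb{R}^d$ and every subgradient $g_i(x)$ of $f_i$ at $x$. Then the iterates of the stochastic subgradient method with the subgradient counterpart of SPS with $c=1$ satisfy, for every $K\ge1$, $$\mathbb{E}\left[f(\bar{x}^K)-f(x^* )\right]\le\frac{G\|x^0-x^*\|}{\sqrt K}=O\left(\frac1{\sqrt K}\right),\qquad \bar{x}^K:=\frac1K\sum_{k=0}^{K-1}x^k.$$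
   Context: Setting: $f(x)=\frac1n\sum_{i=1}^n f_i(x)$ is minimized over $\mathbb{R}^d$, and the set of minimizers of $f$ is nonempty. Stochastic subgradient method: starting from a deterministic $x^0$, at each iteration $k$ an index $i\in\{1,\dots,n\}$ is drawn uniformly at random, independently of the past, and $x^{k+1}=x^k-\gamma_kg_i^k$, where $g_i^k=g_i(x^k)$ is a subgradient of $f_i$ at $x^k$. Subgradient counterpart of SPS with parameter $c>0$: $\gamma_k=\frac{f_i(x^k)-f_i^*}{c\|g_i^k\|^2}$, where $i$ is the index drawn at iteration $k$. If $g_i^k=0$ then $x^{k+1}=x^k$. *)

(* Defs.v *)
From mathcomp Require Import all_boot all_order all_algebra.
From mathcomp Require Import all_classical all_reals all_analysis.

Set Implicit Arguments.
Unset Strict Implicit.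
Unset Printing Implicit Defensive.

Import Order.TTheory GRing.Theory Num.Theory.
Import numFieldNormedType.Exports.

Local Open Scope classical_set_scope.
Local Open Scope ring_scope.

Definition dotp {R : realType} {d : nat} (u v : 'rV[R]_d) : R :=
  \sum_(j < d) u 0 j * v 0 j.

(* The library norm [`|u|] on ['rV[R]_d] is the sup norm, hence this one. *)
Definition enorm {R : realType} {d : nat} (u : 'rV[R]_d) : R :=
  Num.sqrt (dotp u u).

Definition is_subgradient {R : realType} {d : nat} (f : 'rV[R]_d -> R)
    (x v : 'rV[R]_d) : Prop :=
  forall y, f x + dotp v (y - x) <= f y.

Definition minimizer {R : realType} {d : nat} (f : 'rV[R]_d -> R)
    (x : 'rV[R]_d) : Prop :=
  forall y, f x <= f y.

Definition average {R : realType} {d n : nat} (f : 'I_n -> 'rV[R]_d -> R) :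
    'rV[R]_d -> R :=
  fun x => n%:R^-1 * \sum_(i < n) f i x.

(* The infimum is extended-real, so that it is [-oo] when [f] is not bounded
   below; the real-valued [inf] would be 0 in that case. *)
Definition infval {R : realType} {d : nat} (f : 'rV[R]_d -> R) : \bar R :=
  ereal_inf [set (f x)%:E | x in [set: 'rV[R]_d]].

Definition interpolation {R : realType} {d n : nat}
    (f : 'I_n -> 'rV[R]_d -> R) (x : 'rV[R]_d) : Prop :=
  forall i, (f i x)%:E = infval (f i).

(* [fine] only matters when [infval (f i)] is infinite, which interpolation
   excludes. *)
Definition sps_stepsize {R : realType} {d n : nat} (c : R)
    (f : 'I_n -> 'rV[R]_d -> R) (g : 'I_n -> 'rV[R]_d -> 'rV[R]_d)
    (i : 'I_n) (x : 'rV[R]_d) : R :=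
  (f i x - fine (infval (f i))) / (c * enorm (g i x) ^+ 2).

(* [g i x] is the subgradient of [f i] at [x] that the method uses, and
   [ik k] is the index drawn at iteration [k]. *)
Fixpoint sps_iterate {R : realType} {d n : nat} (c : R)
    (f : 'I_n -> 'rV[R]_d -> R) (g : 'I_n -> 'rV[R]_d -> 'rV[R]_d)
    (x0 : 'rV[R]_d) (ik : nat -> 'I_n) (k : nat) : 'rV[R]_d :=
  if k is k'.+1 then
    let x := sps_iterate c f g x0 ik k' in
    let i := ik k' in
    if g i x == 0 then x else x - sps_stepsize c f g i x *: g i x
  else x0.

Definition average_iterate {R : realType} {d : nat} (x : nat -> 'rV[R]_d)
    (K : nat) : 'rV[R]_d :=
  K%:R^-1 *: \sum_(0 <= k < K) x k.

(* Since x^0 is deterministic, an event of the past of iteration [k] is given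
   by a set [H] of possible values of the index history (i_0, ..., i_{k-1}). *)
Definition uniform_independent_draws {R : realType} {dT : measure_display}
    {T : measurableType dT} {n : nat} (P : probability T R)
    (ik : nat -> T -> 'I_n) : Prop :=
  [/\ forall k i, measurable [set w | ik k w = i],
      forall k i, P [set w | ik k w = i] = (n%:R^-1)%:E
    & forall k i (H : set (k.-tuple 'I_n)),
        let past := [set w | H [tuple ik j w | j < k]] in
        P ([set w | ik k w = i] `&` past) =
        (P [set w | ik k w = i] * P past)%E].

(* Main.v *)
(** Write [z] for the minimizer and [a_k = f_i(x^k) - f_i(z)] for the index [i]
    drawn at iteration [k].  On every sample path the step size gives
    [|x^(k+1) - z|^2 <= |x^k - z|^2 - a_k^2 / G^2], so that
    [sum_(k < K) a_k^2 <= G^2 |x^0 - z|^2], and by Cauchy-Schwarz the mean of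
    the [a_k] is at most [G |x^0 - z| / sqrt K].  Since [i] is independent of
    [x^k], the expectations of [a_k] and of [f(x^k) - f(z)] agree, and Jensen's
    inequality passes from the iterates to their average. *)
Require Import Defs.
From mathcomp Require Import all_boot all_order all_algebra.
From mathcomp Require Import all_classical all_reals all_analysis.
From mathcomp Require Import measurable_realfun ring lra.
Import Order.TTheory GRing.Theory Num.Theory.
Import numFieldNormedType.Exports.
Local Open Scope classical_set_scope.
Local Open Scope ring_scope.

(** * Euclidean geometry and a single Polyak step *)

Lemma dotpDr {R : realType} {d : nat} (u v w : 'rV[R]_d) :
  dotp u (v + w) = dotp u v + dotp u w.
Proof.
by rewrite /dotp -big_split; apply: eq_bigr => j _; rewrite mxE mulrDr.
Qed.

Lemma dotp0r {R : realType} {d : nat} (u : 'rV[R]_d) : dotp u 0 = 0.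
Proof. by rewrite /dotp big1 // => j _; rewrite mxE mulr0. Qed.

Lemma dotp0l {R : realType} {d : nat} (u : 'rV[R]_d) : dotp 0 u = 0.
Proof. by rewrite /dotp big1 // => j _; rewrite mxE mul0r. Qed.

Lemma dotp_sumr {R : realType} {d K : nat} (u : 'rV[R]_d)
    (x : 'I_K -> 'rV[R]_d) :
  dotp u (\sum_(k < K) x k) = \sum_(k < K) dotp u (x k).
Proof. by apply: (big_morph _ (dotpDr u) (dotp0r u)). Qed.

Lemma enorm_sqr {R : realType} {d : nat} (u : 'rV[R]_d) :
  enorm u ^+ 2 = dotp u u.
Proof.
by rewrite /enorm sqr_sqrtr // /dotp sumr_ge0 // => j _; rewrite -expr2 sqr_ge0.
Qed.

Lemma enorm_sqr_eq0 {R : realType} {d : nat} (u : 'rV[R]_d) :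
  (enorm u ^+ 2 == 0) = (u == 0).
Proof.
rewrite enorm_sqr /dotp; apply/idP/eqP => [|->]; last first.
  by rewrite big1 // => j _; rewrite mxE mulr0.
rewrite psumr_eq0 => [/allP u0|j _]; last by rewrite -expr2 sqr_ge0.
apply/rowP => j; rewrite mxE; apply/eqP; rewrite -sqrf_eq0 expr2.
by apply: u0; rewrite mem_index_enum.
Qed.

Lemma enorm_sqr_subZ {R : realType} {d : nat} (a : R) (u v : 'rV[R]_d) :
  enorm (u - a *: v) ^+ 2 =
  enorm u ^+ 2 - 2 * a * dotp v u + a ^+ 2 * enorm v ^+ 2.
Proof.
rewrite !enorm_sqr /dotp !mulr_sumr -sumrB -big_split; apply: eq_bigr => j _.
rewrite /= !mxE; ring.
Qed.

(* The step length [a / |v|^2] minimizes the quadratic bound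
   [|x - z|^2 - 2 c a + c^2 |v|^2] in [c], where [a = h x - h z]. *)
Lemma polyak_step_descent {R : realType} {d : nat} (h : 'rV[R]_d -> R)
    (x v z : 'rV[R]_d) (G : R) :
  0 < G -> is_subgradient h x v -> v != 0 -> enorm v ^+ 2 <= G ^+ 2 ->
  h z <= h x ->
  enorm (x - ((h x - h z) / enorm v ^+ 2) *: v - z) ^+ 2 <=
  enorm (x - z) ^+ 2 - (h x - h z) ^+ 2 / G ^+ 2.
Proof.
move=> G0 hv v0 vG hzx; rewrite addrAC enorm_sqr_subZ.
have nv_gt0 : 0 < enorm v ^+ 2 by rewrite lt0r enorm_sqr_eq0 v0 sqr_ge0.
have := hv z; rewrite -opprB -scaleN1r.
have -> : dotp v (-1 *: (x - z)) = - dotp v (x - z).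
  by rewrite /dotp -sumrN; apply: eq_bigr => j _; rewrite !mxE; ring.
move: (enorm v ^+ 2) nv_gt0 vG => q q0 qG hD.
have a0 : 0 <= h x - h z by rewrite subr_ge0.
have aD : h x - h z <= dotp v (x - z) by lra.
move: (h x - h z) (dotp v (x - z)) a0 aD => a D a0 aD.
(* As [a <= D], the cross term [2 * (a / q) * D] is at least [2 * a ^+ 2 / q]; the quadratic term
   takes back [a ^+ 2 / q], so a decrease of [a ^+ 2 / q] remains. *)
have step : a ^+ 2 / q <= a / q * D.
  by rewrite expr2 mulrAC ler_wpM2l // divr_ge0 // ltW.
have -> : (a / q) ^+ 2 * q = a ^+ 2 / q by field; rewrite gt_eqF.
have : a ^+ 2 / G ^+ 2 <= a ^+ 2 / q.
  by rewrite ler_wpM2l ?sqr_ge0 // lef_pV2 // posrE exprn_gt0.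
lra.
Qed.

(** * Descent along a sample path *)

Lemma interpolation_le {R : realType} {d n : nat} (f : 'I_n -> 'rV[R]_d -> R)
    (xstar : 'rV[R]_d) :
  interpolation f xstar -> forall i y, f i xstar <= f i y.
Proof.
move=> fi i y; rewrite -lee_fin fi; apply: ereal_inf_lbound.
by exists y.
Qed.

Lemma subgradient0_min {R : realType} {d : nat} (h : 'rV[R]_d -> R)
    (x : 'rV[R]_d) : is_subgradient h x 0 -> minimizer h x.
Proof. by move=> h0 y; have := h0 y; rewrite dotp0l addr0. Qed.

(** Interpolation identifies the infimum of every [f i] with its value at [xstar], so the step is a
    Polyak step towards the same point whichever index is drawn. *)
Lemma sps_iterate_descent {R : realType} {d n : nat}
    (f : 'I_n -> 'rV[R]_d -> R) (g : 'I_n -> 'rV[R]_d -> 'rV[R]_d)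
    (x0 xstar : 'rV[R]_d) (G : R) (ik : nat -> 'I_n) (k : nat) :
  0 < G -> interpolation f xstar ->
  (forall i x, is_subgradient (f i) x (g i x)) ->
  (forall i x, enorm (g i x) ^+ 2 <= G ^+ 2) ->
  let x := sps_iterate 1 f g x0 ik in
  (enorm (x k.+1 - xstar) ^+ 2 <=
   enorm (x k - xstar) ^+ 2 - (f (ik k) (x k) - f (ik k) xstar) ^+ 2 / G ^+ 2
   : Prop).
Proof.
move=> G0 fi gf gG x.
have fstar := interpolation_le _ _ fi.
rewrite {1}/x /= -/(x k); case: eqVneq => [gx0|gx0].
  (* A zero subgradient makes [x k] a minimizer of the drawn function: the gap vanishes, and so does
     the required decrease. *)
  have xmin : f (ik k) (x k) = f (ik k) xstar.
    apply/eqP; rewrite eq_le fstar andbT; apply: subgradient0_min.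
    by rewrite -gx0.
  by rewrite xmin subrr expr0n mul0r subr0.
rewrite /sps_stepsize -fi /= mul1r.
exact: polyak_step_descent.
Qed.

Lemma sps_sum_gap_sqr_le {R : realType} {d n : nat}
    (f : 'I_n -> 'rV[R]_d -> R) (g : 'I_n -> 'rV[R]_d -> 'rV[R]_d)
    (x0 xstar : 'rV[R]_d) (G : R) (ik : nat -> 'I_n) (K : nat) :
  0 < G -> interpolation f xstar ->
  (forall i x, is_subgradient (f i) x (g i x)) ->
  (forall i x, enorm (g i x) ^+ 2 <= G ^+ 2) ->
  let x := sps_iterate 1 f g x0 ik in
  (\sum_(k < K) (f (ik k) (x k) - f (ik k) xstar) ^+ 2 <=
   G ^+ 2 * enorm (x0 - xstar) ^+ 2 : Prop).
Proof.
move=> G0 fi gf gG x.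
have G20 : 0 < G ^+ 2 by rewrite exprn_gt0.
(* The final distance is kept so that the descent inequalities telescope by induction. *)
suff : \sum_(k < K) (f (ik k) (x k) - f (ik k) xstar) ^+ 2 <=
    G ^+ 2 * (enorm (x0 - xstar) ^+ 2 - enorm (x K - xstar) ^+ 2).
  move/le_trans; apply; rewrite ler_pM2l // lerBlDr lerDl; exact: sqr_ge0.
elim: K => [|K IH]; first by rewrite big_ord0 subrr mulr0.
rewrite big_ord_recr /=.
have : enorm (x K.+1 - xstar) ^+ 2 <= enorm (x K - xstar) ^+ 2 -
    (f (ik K) (x K) - f (ik K) xstar) ^+ 2 / G ^+ 2.
  exact: sps_iterate_descent.
rewrite -(ler_pM2l G20) mulrBr [G ^+ 2 * (_ / _)]mulrC divfK ?gt_eqF //.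
move: IH; rewrite !mulrBr; lra.
Qed.

(** * Cauchy-Schwarz and Jensen for finite averages *)

(** Cauchy-Schwarz in variance form: the sum of the squared deviations from the mean [m] is
    nonnegative and equals the sum of squares minus [K m^2]. *)
Lemma mean_le_sqrt {R : realType} {K : nat} (a : 'I_K -> R) (B : R) :
  (0 < K)%N -> 0 <= B -> \sum_(k < K) a k ^+ 2 <= B ^+ 2 ->
  K%:R^-1 * \sum_(k < K) a k <= B / Num.sqrt K%:R.
Proof.
move=> K0 B0 aB; set m := K%:R^-1 * _.
have K_gt0 : 0 < K%:R :> R by rewrite ltr0n.
have sumE : \sum_(k < K) a k = K%:R * m by rewrite mulVKf // gt_eqF.
have var_ge0 : 0 <= \sum_(k < K) (a k - m) ^+ 2.
  by apply: sumr_ge0 => k _; exact: sqr_ge0.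
have varE : \sum_(k < K) (a k - m) ^+ 2 = \sum_(k < K) a k ^+ 2 - K%:R * m ^+ 2.
  under eq_bigr do rewrite sqrrB.
  rewrite big_split sumrB /= sumr_const card_ord sumrMnl -mulr_suml sumE.
  by rewrite -mulr_natl; ring.
rewrite ler_pdivlMr ?sqrtr_gt0 //.
(* Squaring both sides requires [0 <= m]; for negative [m] the bound is immediate. *)
have [m0|m0] := leP 0 m; last first.
  by apply: le_trans B0; rewrite mulr_le0_ge0 ?sqrtr_ge0 // ltW.
rewrite -ler_sqr ?nnegrE //; last by rewrite (mulr_ge0 m0) ?sqrtr_ge0.
rewrite exprMn (sqr_sqrtr (ltW K_gt0)) mulrC; apply: le_trans aB.
by rewrite -subr_ge0 -varE.
Qed.

(** Sum the subgradient inequalities based at the average: the linear terms cancel because the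
    deviations from the average sum to zero. *)
Lemma subgradient_jensen {R : realType} {d : nat} (h : 'rV[R]_d -> R)
    (v : 'rV[R]_d) (x : nat -> 'rV[R]_d) (K : nat) :
  (0 < K)%N -> is_subgradient h (average_iterate x K) v ->
  h (average_iterate x K) <= K%:R^-1 * \sum_(k < K) h (x k).
Proof.
move=> K0 hv; set y := average_iterate x K in hv *.
have K_gt0 : 0 < K%:R :> R by rewrite ltr0n.
have dot0 : \sum_(k < K) dotp v (x k - y) = 0.
  rewrite -dotp_sumr sumrB sumr_const card_ord -scaler_nat /y /average_iterate.
  by rewrite scalerA mulfV ?gt_eqF // scale1r big_mkord subrr dotp0r.
rewrite ler_pdivlMl //.
have -> : K%:R * h y = \sum_(k < K) (h y + dotp v (x k - y)).
  by rewrite big_split /= dot0 addr0 sumr_const card_ord mulr_natl.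
by apply: ler_sum => k _; exact: hv.
Qed.

Lemma average_jensen {R : realType} {d n : nat} (f : 'I_n -> 'rV[R]_d -> R)
    (g : 'I_n -> 'rV[R]_d -> 'rV[R]_d) (x : nat -> 'rV[R]_d) (K : nat) :
  (forall i x, is_subgradient (f i) x (g i x)) -> (0 < K)%N ->
  average f (average_iterate x K) <= K%:R^-1 * \sum_(k < K) average f (x k).
Proof.
move=> gf K0; rewrite /average -mulr_sumr mulrCA ler_wpM2l ?invr_ge0 ?ler0n //.
rewrite exchange_big mulr_sumr; apply: ler_sum => i _.
exact: subgradient_jensen (gf i _).
Qed.

Lemma averageB {R : realType} {d n : nat} (f : 'I_n -> 'rV[R]_d -> R)
    (x z : 'rV[R]_d) :
  average f x - average f z = n%:R^-1 * \sum_(i < n) (f i x - f i z).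
Proof. by rewrite /average -mulrBr sumrB. Qed.

(** * Finite index histories and their expectations *)

(** Makes the iterate at time [k] a function of the first [k] draws. *)
Lemma eq_sps_iterate {R : realType} {d n : nat} (c : R)
    (f : 'I_n -> 'rV[R]_d -> R) (g : 'I_n -> 'rV[R]_d -> 'rV[R]_d)
    (x0 : 'rV[R]_d) (ik jk : nat -> 'I_n) (k : nat) :
  (forall l, (l < k)%N -> ik l = jk l) ->
  sps_iterate c f g x0 ik k = sps_iterate c f g x0 jk k.
Proof.
elim: k => //= k IH eq_ij; rewrite eq_ij // IH // => l lk.
by apply: eq_ij; exact: ltnW.
Qed.

Lemma measurable_fun_fin_valued {dT : measure_display} {T : measurableType dT}
    {d' : measure_display} {U : measurableType d'} {S : finType}
    (X : T -> S) (phi : S -> U) :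
  (forall s, measurable [set w | X w = s]) ->
  measurable_fun [set: T] (phi \o X).
Proof.
move=> mX _ B _; rewrite setTI.
have -> : (phi \o X) @^-1` B =
    \bigcup_(s in [set s | B (phi s)]) [set w | X w = s].
  by apply/seteqP; split => [w Bw|w [s /[swap] /= <-] //]; exists (X w).
by apply: fin_bigcup_measurable => //; exact: finite_finset.
Qed.

(** [phi (X w)] is a finite combination of indicators of level sets of [X]; nonnegativity lets the
    integral pass through the sum without an integrability condition. *)
Lemma ge0_integral_fin_valued {R : realType} {dT : measure_display}
    {T : measurableType dT} (P : probability T R) {S : finType}
    (X : T -> S) (phi : S -> R) :
  (forall s, measurable [set w | X w = s]) -> (forall s, 0 <= phi s) ->
  (\int[P]_w (phi (X w))%:E = \sum_s (phi s)%:E * P [set w | X w = s])%E.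
Proof.
move=> mX phi0.
have phiE w : ((phi (X w))%:E =
    \sum_s (phi s)%:E * (\1_[set w | X w = s] w)%:E)%E.
  rewrite (bigD1 (X w)) //= big1 => [|s sX].
    by rewrite indicE mem_set // mule1 adde0.
  by rewrite indicE memNset ?mule0 //= => Xs; rewrite Xs eqxx in sX.
have mI s : measurable_fun [set: T] (EFin \o \1_[set w | X w = s] : T -> \bar R).
  by apply/measurable_EFinP; exact: measurable_indic.
under eq_integral do rewrite phiE.
rewrite ge0_integral_sum //; last 2 first.
- move=> s; exact: (emeasurable_funM (measurable_cst (phi s)%:E) (mI s)).
- by move=> s w _; rewrite mule_ge0 ?lee_fin.
apply: eq_bigr => s _; rewrite ge0_integralZl_EFin //; last exact: mI.
by rewrite integral_indic // setIT.
Qed.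

Lemma measurable_past {dT : measure_display} {T : measurableType dT} {n : nat}
    (ik : nat -> T -> 'I_n) (k : nat) (t : k.-tuple 'I_n) :
  (forall k i, measurable [set w | ik k w = i]) ->
  measurable [set w | [tuple ik j w | j < k] = t].
Proof.
move=> mik.
have -> : [set w | [tuple ik j w | j < k] = t] =
    \bigcap_(j in [set: 'I_k]) [set w | ik j w = tnth t j].
  apply/seteqP; split => [w /= <- j _ /=|w /= tw]; first by rewrite tnth_mktuple.
  by apply: eq_from_tnth => j; rewrite tnth_mktuple tw.
by apply: fin_bigcap_measurable => // j _; exact: mik.
Qed.

(** Conditioning on the past in finite form: the pair of draw and history has a product law, and
    summing over the uniform draw first gives the average over [i]. *)
Lemma integral_uniform_draw {R : realType} {dT : measure_display}
    {T : measurableType dT} {n : nat} (P : probability T R)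
    (ik : nat -> T -> 'I_n) (k : nat) (phi : 'I_n -> k.-tuple 'I_n -> R) :
  uniform_independent_draws P ik -> (forall i t, 0 <= phi i t) ->
  let past w := [tuple ik j w | j < k] in
  (\int[P]_w (phi (ik k w) (past w))%:E =
   \int[P]_w (n%:R^-1 * \sum_(i < n) phi i (past w))%:E)%E.
Proof.
case=> mik Pik indep phi0 past.
have mpast t : measurable [set w | past w = t] by exact: measurable_past.
pose p t := fine (P [set w | past w = t]).
have pE t : P [set w | past w = t] = (p t)%:E.
  by rewrite /p fineK // fin_num_measure.
have pairE s : [set w | (ik k w, past w) = s] =
    [set w | ik k w = s.1] `&` [set w | past w = s.2].
  by apply/seteqP; split => w /= => [<-//|]; case: s => i t /= [<- <-].
rewrite (ge0_integral_fin_valued P (fun w => (ik k w, past w))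
  (fun s => phi s.1 s.2)) //; last first.
  by move=> s; rewrite pairE; apply: measurableI.
rewrite (ge0_integral_fin_valued P past
  (fun t => n%:R^-1 * \sum_(i < n) phi i t)) //; last first.
  by move=> t; rewrite mulr_ge0 ?invr_ge0 ?ler0n ?sumr_ge0.
(* Independence is applied to the past event that consists of a single history. *)
have Ppair s : P [set w | (ik k w, past w) = s] = (n%:R^-1 * p s.2)%:E.
  rewrite pairE; apply: etrans (indep k s.1 [set t | t = s.2]) _.
  by rewrite Pik EFinM -pE.
under eq_bigr do rewrite Ppair -EFinM.
under [RHS]eq_bigr do rewrite pE -EFinM.
rewrite !sumEFin; congr EFin.
rewrite -(pair_bigA _ (fun i t => phi i t * (n%:R^-1 * p t))) exchange_big /=.
apply: eq_bigr => t _; rewrite -mulr_suml; ring.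
Qed.

(** * The convergence rate in expectation *)

Theorem theoremC1 (R : realType) (d n : nat) (hn : (0 < n)%N)
  (dT : measure_display) (T : measurableType dT) (P : probability T R)
  (f : 'I_n -> 'rV[R]_d -> R)
  (f_convex : forall i, convex_function [set: convex_lmodType 'rV[R]_d] (f i))
  (avg_convex : convex_function [set: convex_lmodType 'rV[R]_d] (average f))
  (xstar : 'rV[R]_d) (xstar_min : minimizer (average f) xstar)
  (f_interp : interpolation f xstar)
  (G : R) (G_gt0 : 0 < G)
  (G_bound : forall i x v, is_subgradient (f i) x v -> enorm v ^+ 2 < G ^+ 2)
  (g : 'I_n -> 'rV[R]_d -> 'rV[R]_d)
  (g_subgradient : forall i x, is_subgradient (f i) x (g i x))
  (x0 : 'rV[R]_d) (ik : nat -> T -> 'I_n)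
  (ik_draws : uniform_independent_draws P ik) :
  let x (w : T) := sps_iterate 1 f g x0 (fun k => ik k w) in
  let xbar (K : nat) (w : T) := average_iterate (x w) K in
  let bound (K : nat) : R := G * enorm (x0 - xstar) / Num.sqrt K%:R in
  (forall K : nat, (1 <= K)%N ->
    ('E_P[fun w => (average f (xbar K w) - average f xstar)%R]
      <= (bound K)%:E)%E) /\
  bound =O_\oo (fun K : nat => 1 / Num.sqrt K%:R : R).
Proof.
move=> x xbar bound.
have fstar := interpolation_le _ _ f_interp.
have gG i y : enorm (g i y) ^+ 2 <= G ^+ 2 by apply/ltW/(G_bound i y).
have [mik _ _] := ik_draws.
split=> [K K0|]; last first.
  (* The added 1 keeps the constant positive when [x0 = xstar]. *)
  apply/eqO_exP; exists (G * enorm (x0 - xstar) + 1).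
    by rewrite ltr_wpDl // mulr_ge0 ?sqrtr_ge0 // ltW.
  near=> K; rewrite /bound mul1r normrM ler_wpM2r // ger0_norm ?lerDl //.
  by rewrite mulr_ge0 ?sqrtr_ge0 // ltW.
pose past k w := [tuple ik j w | j < k].
pose i0 := Ordinal hn.
(* [xt k t] replays the method along the history [t]; up to time [k] only entries of [t] are read,
   never the default [i0]. *)
pose xt k (t : k.-tuple 'I_n) := sps_iterate 1 f g x0 (nth i0 t).
have xE k l w : (l <= k)%N -> x w l = xt k (past k w) l.
  move=> lk; apply: eq_sps_iterate => j jl.
  have jk : (j < k)%N by exact: leq_trans lk.
  by rewrite -[j]/(val (Ordinal jk)) -tnth_nth tnth_mktuple.
pose a k w := f (ik k w) (x w k) - f (ik k w) xstar.
pose D k w := average f (x w k) - average f xstar.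
have a_ge0 k w : 0 <= a k w by rewrite subr_ge0.
have D_ge0 k w : 0 <= D k w by rewrite subr_ge0.
have mpast k t : measurable [set w | past k w = t] by exact: measurable_past.
have mfun k (phi : k.-tuple 'I_n -> R) (b : T -> R) :
    (forall w, b w = phi (past k w)) ->
    measurable_fun [set: T] (EFin \o b).
  move=> bE; apply/measurable_EFinP.
  rewrite (_ : b = phi \o past k); last exact/funext.
  exact: (measurable_fun_fin_valued (past k) phi (mpast k)).
have mD k : measurable_fun [set: T] (EFin \o D k).
  apply: (mfun k (fun t => average f (xt k t k) - average f xstar)) => w.
  by rewrite /D (xE k).
have ma k : measurable_fun [set: T] (EFin \o a k).
  (* [a k] also involves the draw at time [k], hence a history of length [k.+1] with that draw as
     last entry. *)
  pose ilast (t : k.+1.-tuple 'I_n) := tnth t ord_max.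
  apply: (mfun k.+1
    (fun t => f (ilast t) (xt k.+1 t k) - f (ilast t) xstar)) => w.
  by rewrite /a /ilast tnth_mktuple (xE k.+1).
have mbar : measurable_fun [set: T]
    (EFin \o (fun w => average f (xbar K w) - average f xstar)).
  apply: (mfun K (fun t => average f (average_iterate (xt K t) K)
    - average f xstar)) => w.
  rewrite /xbar /average_iterate; congr (average f (_ *: _) - _).
  by rewrite !big_mkord; apply: eq_bigr => l _; rewrite (xE K) // ltnW.
(* The iterate depends on the past alone, so averaging over the fresh draw turns [f i] into
   [average f]. *)
have intDa k : (\int[P]_w (D k w)%:E = \int[P]_w (a k w)%:E)%E.
  pose phi i t := f i (xt k t k) - f i xstar.
  transitivity (\int[P]_w (phi (ik k w) (past k w))%:E)%E; last first.
    by apply: eq_integral => w _; rewrite /a (xE k).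
  rewrite (integral_uniform_draw P ik k phi) //; last first.
    by move=> i t; rewrite subr_ge0.
  by apply: eq_integral => w _; rewrite /D averageB (xE k).
have Kinv : 0 <= K%:R^-1 :> R by rewrite invr_ge0 ler0n.
have m_mean (b : nat -> T -> R) :
    (forall k, measurable_fun [set: T] (EFin \o b k)) ->
    measurable_fun [set: T] (EFin \o (fun w => K%:R^-1 * \sum_(k < K) b k w)).
  move=> mb; apply/measurable_EFinP; apply: measurable_funM => //.
  by apply: measurable_sum => k; exact/measurable_EFinP.
have int_mean (b : nat -> T -> R) :
    (forall k, measurable_fun [set: T] (EFin \o b k)) ->
    (forall k w, 0 <= b k w) ->
    (\int[P]_w (K%:R^-1 * \sum_(k < K) b k w)%:E =
     K%:R^-1%:E * \sum_(k < K) \int[P]_w (b k w)%:E)%E.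
  move=> mb b0.
  rewrite -(ge0_integral_sum P measurableT
    (f := fun (k : 'I_K) w => (b k w)%:E)); last 2 first.
  - by move=> k; exact: mb.
  - by move=> k w _; rewrite lee_fin.
  rewrite -ge0_integralZl_EFin //.
  - by apply: eq_integral => w _; rewrite EFinM sumEFin.
  - by move=> w _; rewrite sume_ge0 // => k _; rewrite lee_fin.
  - by apply: emeasurable_sum => k; exact: mb.
rewrite unlock.
(* Jensen bounds the gap at [xbar] by the mean of the [D k]; in expectation these are replaced by
   the [a k], which are then bounded pathwise. *)
apply: (@le_trans _ _ (\int[P]_w (K%:R^-1 * \sum_(k < K) D k w)%:E)%E).
  apply: ge0_le_integral => //.
  - by move=> w _; rewrite lee_fin subr_ge0.
  - exact: m_mean.
  - move=> w _; rewrite lee_fin /D sumrB sumr_const card_ord mulrBr.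
    rewrite -(mulr_natl (average f xstar)) mulKf ?pnatr_eq0 -?lt0n // lerB //.
    exact: average_jensen.
rewrite int_mean //; under eq_bigr do rewrite intDa.
rewrite -int_mean //.
(* Since [P] has mass 1, the bound is the integral of a constant, and a pointwise comparison
   suffices. *)
rewrite -[leRHS]mule1 -(@probability_setT _ _ _ P) -integral_cst //.
apply: ge0_le_integral => //.
- by move=> w _; rewrite lee_fin mulr_ge0 // sumr_ge0.
- exact: m_mean.
- move=> w _; rewrite lee_fin; apply: mean_le_sqrt => //.
    by rewrite mulr_ge0 ?sqrtr_ge0 // ltW.
  by rewrite exprMn; exact: sps_sum_gap_sqr_le.
Unshelve. all: by end_near.
Qed.
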